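(* Let $P$ be a given function of the density $\rho\in[0,\rho_{\max}]$ with values in $[0,1]$, let $V_{\max}>0$, and fix $\Delta v=V_{\max}/T$ with $T\in\mathbb{N}$, $T\ge 1$. For $r\in\mathbb{N}$, $r\ge 1$, let $N=rT+1$, so that the grid spacing $\delta v=V_{\max}/(N-1)$ satisfies $\Delta v=r\,\delta v$, and let $\mathbf{f}_r=\mathbf{f}_r(\rho)\in\mathbb{R}^{N}$ denote the equilibrium distribution of the discretized $\delta$ model on this grid (the ODE system for $f_1,\dots,f_N$ written in the context) with total density $\rho$. In particular $\mathbf{f}_1\in\mathbb{R}^{T+1}$ is the equilibrium obtained for $r=1$. Then, for every such $r$, the vector given by $$(\mathbf{f}_r)_j=\begin{cases}(\mathbf{f}_1)_{\lceil j/r\rceil} & \text{if } j-1\equiv 0 \pmod r,\\ 0 & \text{otherwise,}\end{cases}\qquad j=1,\dots,N,$$ is the unique stable equilibrium of the system, and the values of $\mathbf{f}_1$ depend uniquely on the initial density $\rho$ (that is, for given $T$ and $P$ they are determined by $\rho$), with $\sum_{k=1}^{T+1}(\mathbf{f}_1)_k=\rho$.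
   Context: Here $\lceil x\rceil$ is the smallest integer not less than $x$, and $\eta>0$ is a constant (the interaction rate). The density $\rho$ is constant in time, and $P=P(\rho)$ is a fixed number once $\rho$ is fixed. The discretized $\delta$ model on the grid with $N=rT+1$ cells, $r=\Delta v/\delta v\in\mathbb{N}$, is the following ODE system for $\mathbf{f}(t)=(f_1(t),\dots,f_N(t))$, where $f_j(t)\ge 0$ is the number of vehicles with speed in the $j$-th velocity cell $I_j=[(j-\tfrac32)\delta v,(j-\tfrac12)\delta v]\cap[0,V_{\max}]$, and $\sum_{k=1}^N f_k(t)=\rho$ for all $t$: For $1\le j\le r$: $$\frac1\eta f_j'=(1-P)f_j^2+2(1-P)f_j\sum_{k=j+1}^{N}f_k-\rho f_j.$$ For $r+1\le j\le N-1$: $$\frac1\eta f_j'=(1-P)f_j^2+2(1-P)f_j\sum_{k=j+1}^{N}f_k+P\rho f_{j-r}-\rho f_j.$$ For $j=N$: $$\frac1\eta f_N'=(1-P)f_N^2+P\rho\sum_{h=N-r}^{N}f_h-\rho f_N.$$ The initial condition satisfies $f_j(0)\ge 0$ for all $j$ and $\sum_{j=1}^N f_j(0)=\rho$; these two properties are preserved by the flow, so the phase space is $\{\mathbf{f}\in\mathbb{R}^N: f_j\ge 0,\ \sum_j f_j=\rho\}$. An equilibrium is a point of the phase space at which all right-hand sides vanish; ''stable'' means stable in the usual (Lyapunov) sense for the ODE system restricted to this phase space. *)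

(* Defs.v *)
From HB Require Import structures.
From mathcomp Require Export all_boot all_order all_algebra.
From mathcomp Require Export all_classical all_reals all_analysis.

Set Implicit Arguments.
Unset Strict Implicit.
Unset Printing Implicit Defensive.

Import Order.TTheory GRing.Theory Num.Theory.
Import numFieldNormedType.Exports.

Local Open Scope classical_set_scope.
Local Open Scope ring_scope.

Section AutonomousODE.
Context {R : realType} {n : nat}.
Implicit Types (F : 'rV[R]_n.+1 -> 'rV[R]_n.+1) (X : set 'rV[R]_n.+1).

(* The values of x at negative times are irrelevant. *)
Definition solution F (x : R -> 'rV[R]_n.+1) : Prop :=
  forall i : 'I_n.+1,
    {within `[0, +oo[, continuous (fun t => x t 0 i)} /\
    forall t : R, 0 < t -> is_derive t 1 (fun s => x s 0 i) (F (x t) 0 i).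

Definition equilibrium F X (e : 'rV[R]_n.+1) : Prop := X e /\ F e = 0.

(* Only the initial datum is required to lie in X: invariance of X under the
   flow is not part of the definition. The norm is the sup norm of R^(n+1). *)
Definition lyapunov_stable F X (e : 'rV[R]_n.+1) : Prop :=
  forall eps : R, 0 < eps -> exists2 delta : R, 0 < delta &
    forall x : R -> 'rV[R]_n.+1, solution F x -> X (x 0) ->
      `|x 0 - e| < delta -> forall t : R, 0 <= t -> `|x t - e| < eps.

Definition stable_equilibrium F X (e : 'rV[R]_n.+1) : Prop :=
  equilibrium F X e /\ lyapunov_stable F X e.

End AutonomousODE.

Section DeltaModel.
Context {R : realType}.

(* Component number j of f with 1-based indexing, 1 <= j <= n + 1. *)
Definition cell n (f : 'rV[R]_n.+1) (j : nat) : R := f 0 (inord j.-1).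

Definition phase_space n (rho : R) : set 'rV[R]_n.+1 :=
  [set f | (forall i, 0 <= f 0 i) /\ \sum_i f 0 i = rho].

(* Right-hand side of the equation for f_j, 1 <= j <= N, with N = r * T + 1
   cells; p is the value of P at the density rho. *)
Definition delta_rate (T r : nat) (eta p rho : R) (f : 'rV[R]_(r * T).+1)
    (j : nat) : R :=
  let N := (r * T).+1 in
  eta *
  (if (j <= r)%N then
     (1 - p) * cell f j ^+ 2
     + 2 * (1 - p) * cell f j * (\sum_(j.+1 <= k < N.+1) cell f k)
     - rho * cell f j
   else if (j <= N.-1)%N then
     (1 - p) * cell f j ^+ 2
     + 2 * (1 - p) * cell f j * (\sum_(j.+1 <= k < N.+1) cell f k)
     + p * rho * cell f (j - r) - rho * cell f j
   else
     (1 - p) * cell f N ^+ 2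
     + p * rho * (\sum_(N - r <= h < N.+1) cell f h)
     - rho * cell f N).

Definition delta_field (T r : nat) (eta p rho : R) (f : 'rV[R]_(r * T).+1) :
    'rV[R]_(r * T).+1 :=
  \row_(i < (r * T).+1) delta_rate eta p rho f i.+1.

Definition delta_stable_equilibrium (T r : nat) (eta p rho : R)
    (e : 'rV[R]_(r * T).+1) : Prop :=
  stable_equilibrium (delta_field eta p rho) (phase_space rho) e.

(* The vector on the grid with r * T + 1 cells built from f1, a vector on the
   grid r = 1. Here j = i + 1, so j - 1 is i. *)
Definition refine_grid (T r : nat) (f1 : 'rV[R]_(1 * T).+1) :
    'rV[R]_(r * T).+1 :=
  \row_(i < (r * T).+1)
    (if i == 0 %[mod r]
     then cell f1 `|Num.ceil (i.+1%:R / r%:R : R)|%N else 0).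

End DeltaModel.

(* Main.v *)
Require Import Defs.
From mathcomp Require Import ring lra.

(** The proof rests on the tails [G_i = f_(i+1) + ... + f_N], 0 <= i <= rT.
    Summing the equations of the model, each tail solves the scalar equation

      G_i' = eta ((1 - p) G_i^2 - rho G_i + p rho G_(i-r)),

    with the convention that the index i - r is replaced by 0 when negative
    ([delta_fieldE], [solution_tail]). The system is thus a family of chains,
    all driven by the constant total mass G_0 = rho. In particular an
    equilibrium is obtained by solving, along each chain, the quadratic equation
    (1 - p) y'^2 - rho y' + p rho y = 0 for y' given y. Taking the smaller root
    at each step yields a sequence rho = y_0 >= y_1 >= ... ([chain]) that does
    not depend on r, and the equilibrium whose tails are
    G_i = y_(ceil(i / r)) is the one of the theorem ([stable_point],
    [refine_stable_point]): two consecutive tails differ only when r divides i.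

    Stability. The deviation w_i = y_(ceil(i / r)) - G_i satisfies
    w_i' = eta (- (1 - p) w_i^2 - d_i w_i + p rho w_(i-r)), where
    d_i = rho - 2 (1 - p) y_(ceil(i / r)) is, for i > 0, the square root of the
    discriminant. If p < 1/2 and rho > 0, every d_i with i > 0 is positive. If
    p >= 1/2 or rho = 0, all y_m equal rho, so that w_i >= 0 along every
    trajectory and both damping terms have the right sign; the quadratic one
    suffices when d_i = 0. In both cases a small deviation of G_(i-r) entails a
    small deviation of G_i ([deviations_small]), by a comparison principle
    ([comparison_le]).

    Uniqueness. If p >= 1/2 or rho = 0 there is no other equilibrium. Otherwise
    the equilibrium is unique as soon as f_1 > 0, because the tails are then
    too small to be the larger roots ([equilibrium_eq_stable_point]). An
    equilibrium with f_1 = 0 is unstable: f_1 obeys the logistic equation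
    f_1' = eta f_1 ((1 - 2p) rho - (1 - p) f_1), so a trajectory that starts
    nearby with f_1 > 0 leaves a fixed neighbourhood
    ([empty_first_cell_unstable]). This needs trajectories to exist: a global
    Picard-Lindelof theorem for Lipschitz fields ([picard_lindelof]) is applied
    to the equations of the tails with arguments clamped to [0, rho], an
    interval that the solutions never leave ([solution_exists]). *)

Set Implicit Arguments.
Unset Strict Implicit.
Unset Printing Implicit Defensive.

Import Order.TTheory GRing.Theory Num.Theory.
Import numFieldNormedType.Exports.
Local Open Scope ring_scope.

(** * Comparison of differentiable functions on the half-line *)

Section Comparison.
Local Open Scope classical_set_scope.
Local Open Scope ring_scope.
Context {R : realType}.
Implicit Types (u : R -> R) (t s b : R).

Lemma within_cvg_dist u t : {within `[0, +oo[, continuous u} -> 0 <= t ->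
  forall e, 0 < e ->
  exists2 d, 0 < d & forall s, 0 <= s -> `|s - t| < d -> `|u s - u t| < e.
Proof.
move=> /subspace_continuousP uc t0 e e0.
have /uc/cvgrPdist_lt/(_ _ e0) : `[0, +oo[%classic t by rewrite /= in_itv/= t0.
rewrite near_withinE => -[d /= d0 H]; exists d => // s s0 st.
rewrite distrC; apply: (H s); first by rewrite /ball_/= distrC.
by rewrite /= in_itv/= s0.
Qed.

(** A function that is negative at 0, and whose derivative is negative at each of
    its zeros in ]0, b], is negative on [0, b]. *)
Lemma first_crossing u (du : R -> R) b :
  {within `[0, +oo[, continuous u} ->
  (forall t, 0 < t -> is_derive t 1 u (du t)) ->
  u 0 < 0 ->
  (forall t, 0 < t <= b -> u t = 0 -> du t < 0) ->
  forall t, 0 <= t <= b -> u t < 0.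
Proof.
move=> uc ud u0 cross c /andP[c0 cb]; rewrite ltNge; apply/negP => uc0.
pose A : set R := [set t | 0 <= t <= c /\ 0 <= u t].
have Ac : A c by split; rewrite ?c0 ?lexx.
have Alb : has_lbound A by exists 0 => t [/andP[]].
have Ainf : has_inf A by split; [exists c|].
pose m := inf A.
have m0 : 0 <= m by apply: lb_le_inf; [exists c|move=> t [/andP[]]].
have mc : m <= c by apply: ge_inf.
have um t : 0 <= t < m -> u t < 0.
  move=> /andP[t0 tm]; rewrite ltNge; apply/negP => ut.
  suff : m <= t by rewrite leNgt tm.
  by apply: ge_inf => //; split; rewrite // t0/= (le_trans (ltW tm) mc).
have um0 : 0 <= u m.
  rewrite leNgt; apply/negP => umlt.
  have e0 : 0 < - u m by rewrite oppr_gt0.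
  have [d d0 H] := within_cvg_dist uc m0 e0.
  have [t [/andP[t0 tc] ut] tm] := inf_adherent d0 Ainf.
  have mt : m <= t by apply: ge_inf => //; split; rewrite ?t0.
  have := H t t0; rewrite ger0_norm ?subr_ge0// ltrBlDl.
  move=> /(_ tm); rewrite ltr_norml => /andP[_]; rewrite ltrBlDr addNr.
  by rewrite ltNge ut.
have m_gt0 : 0 < m.
  rewrite lt_neqAle m0 andbT; apply/eqP => m0E.
  by move: um0; rewrite -m0E leNgt u0.
have um_le0 : u m <= 0.
  rewrite leNgt; apply/negP => umgt.
  have [d d0 H] := within_cvg_dist uc m0 umgt.
  pose t := m - Num.min (d / 2) m.
  have t0 : 0 <= t by rewrite /t subr_ge0 ge_min lexx orbT.
  have tm : t < m by rewrite /t ltrBlDr ltrDl lt_min divr_gt0.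
  have ut : u t < 0 by apply: um; rewrite t0.
  have /(H t t0) : `|t - m| < d.
    rewrite /t addrAC subrr add0r normrN gtr0_norm ?lt_min ?divr_gt0//.
    by rewrite gt_min ltr_pdivrMr// ltr_pMr// ltr1n.
  by rewrite ltr_norml => /andP[+ _]; lra.
(* At the first zero m the values on the left are negative, hence u'(m) >= 0. *)
have umE : u m = 0 by apply/eqP; rewrite eq_le um_le0.
have dm : du m < 0 by apply: cross; rewrite // m_gt0 (le_trans mc).
have /is_derive1_caratheodory[h [hE hc hm]] := ud _ m_gt0.
move/cvgrPdist_lt: hc => /(_ (- h m)); rewrite oppr_gt0 hm => /(_ dm)[d/= d0 H].
pose t := m - Num.min (d / 2) m.
have t0 : 0 <= t by rewrite /t subr_ge0 ge_min lexx orbT.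
have tm : t < m by rewrite /t ltrBlDr ltrDl lt_min divr_gt0.
have /H : `|m - t| < d.
  rewrite /t opprB addrC subrK gtr0_norm ?lt_min ?divr_gt0//.
  by rewrite gt_min ltr_pdivrMr// ltr_pMr// ltr1n.
rewrite ltr_norml => /andP[+ _] => /= dht.
have ht0 : h t < 0 by lra.
have := um t; rewrite t0 tm => /(_ isT).
have := hE t; rewrite umE subr0 => ->.
by rewrite nmulr_rlt0// subr_gt0 ltNge (ltW tm).
Qed.

Lemma is_derive_expRM k t :
  is_derive t 1 (fun s => expR (k * s)) (k * expR (k * t)).
Proof.
have kd : is_derive t 1 (k \*: (@id R)) k.
  by apply: is_derive_eq; rewrite /GRing.scale/= mulr1.
have := @is_derive1_comp _ expR (k \*: (@id R)) t _ _ (is_derive_expR _) kd.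
by move=> ?; apply: is_derive_eq; rewrite mulrC.
Qed.

(** A differential inequality required only while 0 < u <= c is enough: the
    barriers e * expR ((|K| + 1) t), for small e, cannot be crossed on a bounded
    interval. *)
Lemma comparison_le0 u (du : R -> R) (c K : R) :
  {within `[0, +oo[, continuous u} ->
  (forall t, 0 < t -> is_derive t 1 u (du t)) ->
  0 < c -> u 0 <= 0 ->
  (forall t, 0 < t -> 0 < u t <= c -> du t <= K * u t) ->
  forall t, 0 <= t -> u t <= 0.
Proof.
move=> uc ud c0 u0 H b b0; rewrite leNgt; apply/negP => ub.
pose k := `|K| + 1; pose E t := expR (k * t).
have k0 : 0 < k by rewrite /k ltr_wpDl.
(* With this e the barrier stays below c on [0, b] and reaches at most u b. *)
pose e := Num.min c (u b) / E b.
have E0 t : 0 < E t by exact: expR_gt0.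
have e0 : 0 < e by rewrite divr_gt0// lt_min c0.
have Ed t : is_derive t 1 (fun t => e * E t) (e * (k * E t)).
  exact: is_deriveZ (is_derive_expRM k t).
have zd t : 0 < t -> is_derive t 1 (u - (fun t => e * E t)) (du t - e * (k * E t)).
  by move=> t0; have := ud _ t0; move=> ?; apply: is_deriveB.
have zc : {within `[0, +oo[, continuous (u - (fun t => e * E t))}.
  apply: within_continuousB => //; apply: continuous_subspaceT => t.
  by apply: differentiable_continuous; apply/derivable1_diffP; case: (Ed t).
have z0 : (u - (fun t => e * E t)) 0 < 0.
  by rewrite !fctE /E mulr0 expR0 mulr1; lra.
have : (u - (fun t => e * E t)) b < 0.
  apply: (first_crossing zc zd z0 (b := b)); last by rewrite b0 lexx.
  move=> t /andP[t0 tb]; rewrite !fctE => /eqP; rewrite subr_eq0 => /eqP utE.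
  have ut : 0 < u t <= c.
    rewrite utE mulr_gt0//=.
    apply: (@le_trans _ _ (e * E b)).
      by rewrite ler_pM2l// ler_expR ler_pM2l.
    by rewrite /e divfK ?gt_eqF// ge_min lexx.
  apply: le_lt_trans (lerB (H _ t0 ut) (lexx _)) _.
  rewrite mulrCA -utE -mulrBl nmulr_rlt0; first by case/andP: ut.
  by have := ler_norm K; rewrite /k; lra.
rewrite !fctE /e divfK ?gt_eqF// subr_lt0 lt_min.
by rewrite ltxx andbF.
Qed.

Lemma comparison_le (u v du dv : R -> R) (c K : R) :
  {within `[0, +oo[, continuous u} -> {within `[0, +oo[, continuous v} ->
  (forall t, 0 < t -> is_derive t 1 u (du t)) ->
  (forall t, 0 < t -> is_derive t 1 v (dv t)) ->
  0 < c -> u 0 <= v 0 ->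
  (forall t, 0 < t -> 0 < u t - v t <= c -> du t - dv t <= K * (u t - v t)) ->
  forall t, 0 <= t -> u t <= v t.
Proof.
move=> uc vc ud vd c0 uv0 H t t0; rewrite -subr_le0.
pose z : R -> R := u - v; pose dz t : R := du t - dv t.
have zc : {within `[0, +oo[, continuous z} by exact: within_continuousB.
have zd s : 0 < s -> is_derive s 1 z (dz s).
  by move=> s0; have ? := ud s s0; have ? := vd s s0; exact: is_deriveB.
have z0 : z 0 <= 0 by rewrite /z !fctE subr_le0.
exact: (comparison_le0 zc zd c0 z0 H t0).
Qed.

Lemma within_cst (a : R) : {within `[0, +oo[, continuous (fun _ : R => a)}.
Proof. by apply: continuous_subspaceT => s; exact: cvg_cst. Qed.

Lemma within_expRM (a k : R) :
  {within `[0, +oo[, continuous (fun t : R => a * expR (k * t))}.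
Proof.
apply: continuous_subspaceT => s.
have : is_derive s 1 (fun t : R => a * expR (k * t)) (a * (k * expR (k * s))).
  exact: is_deriveZ (is_derive_expRM k s).
by case=> d _; apply: differentiable_continuous; apply/derivable1_diffP.
Qed.

End Comparison.

(** * Primitives, weighted bounds and geometric limits *)

Section Preliminaries.
Local Open Scope classical_set_scope.
Local Open Scope ring_scope.
Context {R : realType}.
Implicit Types s t : R.

Lemma row_normP m (x : 'rV[R]_m) d : 0 <= d ->
  reflect (forall i, `|x 0 i| <= d) (`|x| <= d).
Proof.
move=> d0; rewrite [`|x|]/Num.norm/= mx_normrE; apply: (iffP idP).
  by move=> /bigmax_leP[_ H] i; exact: (H (0, i)).
by move=> H; apply/bigmax_leP; split => // -[j i] _ /=; rewrite ord1.
Qed.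

Lemma row_norm_ge m (x : 'rV[R]_m) i : `|x 0 i| <= `|x|.
Proof. exact/row_normP. Qed.

Lemma row_subE m (v w : 'rV[R]_m) i : (v - w) 0 i = v 0 i - w 0 i.
Proof. by rewrite !mxE. Qed.

Lemma continuous_row m (x : R -> 'rV[R]_m) (t : R) :
  (forall i, {for t, continuous (fun s => x s 0 i)}) -> {for t, continuous x}.
Proof.
move=> xc; apply/cvgrPdist_le => e e0.
have xe i : \forall s \near t, `|x t 0 i - x s 0 i| <= e.
  by move/cvgrPdist_le: (xc i) => /(_ _ e0).
near=> s; apply/row_normP; first exact: ltW.
move=> i; rewrite !mxE; move: i; near: s.
exact: filter_forall.
Unshelve. all: by end_near. Qed.

Lemma dist_max0 (s t : R) : `|Num.max s 0 - Num.max t 0| <= `|s - t|.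
Proof.
have : s - t <= `|s - t| by exact: ler_norm.
have : - (s - t) <= `|s - t| by rewrite -normrN ler_norm.
have : 0 <= `|s - t| by [].
move: `|s - t| => d d0 dn dp; rewrite ler_norml.
by case: (leP s 0) => s0; case: (leP t 0) => t0; apply/andP; split; lra.
Qed.

Lemma continuous_max0 : continuous (fun t : R => Num.max t 0).
Proof.
move=> t; apply/cvgrPdist_le => e e0.
near=> s; apply: (le_trans (dist_max0 _ _)); near: s.
by apply: cvgr_dist_le.
Unshelve. all: by end_near. Qed.

(** The primitive of h that vanishes at 0, meaningful for t >= -1. Integrating
    from -1 makes it differentiable, in the two-sided sense, at 0 as well. *)
Definition primitive (h : R -> R) (t : R) : R :=
  (\int[lebesgue_measure]_(s in `[-1, t]) h s) -
  (\int[lebesgue_measure]_(s in `[-1, 0%R]) h s).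

Lemma primitive0 h : primitive h 0 = 0.
Proof. exact: subrr. Qed.

Lemma is_derive_primitive (h : R -> R) (t : R) : continuous h -> -1 < t ->
  is_derive t 1 (primitive h) (h t).
Proof.
move=> hc t1.
have hi : lebesgue_measure.-integrable `[-1, t + 1] (EFin \o h).
  apply: continuous_compact_integrable; first exact: segment_compact.
  by apply: continuous_subspaceT => s; exact: hc.
have tt : t < t + 1 by rewrite ltrDl.
pose G (x : R) : R := \int[lebesgue_measure]_(s in `[-1, x]) h s.
have -> : primitive h = G - cst (G 0) by [].
have [Gd Ge] : derivable G t 1 /\ derive1 G t = h t.
  exact: continuous_FTC1_closed tt hi t1 (hc t).
clearbody G; have dG : is_derive t 1 G (h t).
  by rewrite -Ge derive1E; exact: derivableP.
by have := is_deriveB dG (is_derive_cst (G 0) t 1); rewrite subr0.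
Qed.

Lemma derive_weighted_bound (g dg : R -> R) (C k : R) :
  {within `[0, +oo[, continuous g} ->
  (forall t, 0 < t -> is_derive t 1 g (dg t)) ->
  `|g 0| <= C ->
  (forall t, 0 < t -> `|dg t| <= C * (k * expR (k * t))) ->
  forall t, 0 <= t -> `|g t| <= C * expR (k * t).
Proof.
move=> gc gd g0 H t t0.
have Ed D s : 0 < s ->
    is_derive s 1 (fun t => D * expR (k * t)) (D * (k * expR (k * s))).
  by move=> _; exact: is_deriveZ (is_derive_expRM k s).
move: g0; rewrite !ler_norml => /andP[g0l g0u]; apply/andP; split.
- rewrite -mulNr.
  apply: (comparison_le (@within_expRM _ (- C) k) gc (Ed (- C)) gd ltr01 (K := 0) _ _ t0).
    by rewrite mulr0 expR0 mulr1.
  move=> s s0 _; rewrite mul0r subr_le0 mulNr.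
  by have := H _ s0; rewrite ler_norml => /andP[].
- apply: (comparison_le gc (@within_expRM _ C k) gd (Ed C) ltr01 (K := 0) _ _ t0).
    by rewrite mulr0 expR0 mulr1.
  by move=> s s0 _; rewrite mul0r subr_le0 (le_trans (ler_norm _))// H.
Qed.

(** The limit is obtained as the supremum of the lower bounds
    a n - 2 B / 2 ^ n, which increase. *)
Lemma geometric_limit (a : nat -> R) (B : R) :
  (forall n, `|a n.+1 - a n| <= B / 2 ^+ n) ->
  exists l, forall n, `|l - a n| <= 2 * B / 2 ^+ n.
Proof.
move=> H; pose lo n := a n - 2 * B / 2 ^+ n; pose hi n := a n + 2 * B / 2 ^+ n.
have halve n : 2 * B / 2 ^+ n.+1 = B / 2 ^+ n.
  by rewrite exprS invfM; field; rewrite expf_eq0/= pnatr_eq0 andbF.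
have step n : lo n <= lo n.+1 /\ hi n.+1 <= hi n.
  have := H n; rewrite /lo /hi halve ler_norml => /andP[].
  by move=> ? ?; split; lra.
have lohi n : lo n <= hi n.
  have : 0 <= B / 2 ^+ n by exact: le_trans (H n).
  by rewrite /lo /hi; lra.
have lo_le m n : lo n <= lo (n + m)%N.
  elim: m => [|m IH]; first by rewrite addn0.
  by rewrite addnS; apply: (le_trans IH); case: (step (n + m)%N).
have hi_le m n : hi (n + m)%N <= hi n.
  elim: m => [|m IH]; first by rewrite addn0.
  by rewrite addnS; apply: (le_trans _ IH); case: (step (n + m)%N).
have cross m n : lo m <= hi n.
  apply: (le_trans (lo_le n m)); apply: (le_trans (lohi _)).
  by rewrite addnC; exact: hi_le.
have ub : has_ubound (range lo) by exists (hi 0) => _ [m _ <-]; exact: cross.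
exists (sup (range lo)) => n.
have : lo n <= sup (range lo) by apply: ub_le_sup => //; exists n.
have : sup (range lo) <= hi n.
  by apply: ge_sup; [exists (lo 0), 0|move=> _ [m _ <-]; exact: cross].
by rewrite /lo /hi ler_norml => ? ?; apply/andP; split; lra.
Qed.

Lemma le_geometric_le0 (d K : R) : (forall m, d <= K / 2 ^+ m) -> d <= 0.
Proof.
move=> H; rewrite leNgt; apply/negP => d0.
have K0 : 0 <= K by have := H 0%N; rewrite expr0 divr1; exact: le_trans (ltW d0).
have := archi_boundP (divr_ge0 K0 (ltW d0)); set m := Num.bound _.
rewrite ltr_pdivrMr// => Km.
have := H m; rewrite ler_pdivlMr ?exprn_gt0// => /le_lt_trans/(_ Km).
rewrite mulrC ltr_pM2r// -natrX ltr_nat ltnNge => /negP; apply.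
by rewrite ltnW// ltn_expl.
Qed.

End Preliminaries.

(** * Global solutions of Lipschitz autonomous systems *)

Section GlobalExistence.
Local Open Scope classical_set_scope.
Local Open Scope ring_scope.
Context {R : realType} (n : nat).
Variables (F : 'rV[R]_n.+1 -> 'rV[R]_n.+1) (L : R).
Hypothesis L0 : 0 < L.
Hypothesis FL : forall x y, `|F x - F y| <= L * `|x - y|.
Variable x0 : 'rV[R]_n.+1.
Implicit Types (x y : R -> 'rV[R]_n.+1) (s t : R).

(* Paths matter on [0, +oo[ only; they are extended by their value at 0. *)
Let path_continuous x := continuous (fun t => x (Num.max t 0)).

(** The Picard operator, t |-> x0 + \int_0^t F (x s) ds for t >= 0. *)
Definition picard_step x t : 'rV[R]_n.+1 :=
  \row_i (x0 0 i + primitive (fun s => F (x (Num.max s 0)) 0 i) t).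

Lemma picard_step0 x : picard_step x 0 = x0.
Proof. by apply/rowP => i; rewrite mxE primitive0 addr0. Qed.

Lemma continuous_lipschitz_path x i : path_continuous x ->
  continuous (fun s => F (x (Num.max s 0)) 0 i).
Proof.
move=> xc t; apply/cvgrPdist_lt => e e0.
have eL : 0 < e / L by exact: divr_gt0.
move/cvgrPdist_lt: (xc t) => /(_ _ eL); apply: filterS => s H.
have -> : F (x (Num.max t 0)) 0 i - F (x (Num.max s 0)) 0 i =
  (F (x (Num.max t 0)) - F (x (Num.max s 0))) 0 i by rewrite !mxE.
apply: (le_lt_trans (row_norm_ge _ _)); apply: (le_lt_trans (FL _ _)).
by rewrite mulrC -ltr_pdivlMr.
Qed.

Lemma is_derive_picard_step x t i : path_continuous x -> -1 < t ->
  is_derive t 1 (fun t => picard_step x t 0 i) (F (x (Num.max t 0)) 0 i).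
Proof.
move=> xc t1.
have -> : (fun t => picard_step x t 0 i) =
    cst (x0 0 i) + primitive (fun s => F (x (Num.max s 0)) 0 i).
  by apply/funext => s; rewrite mxE !fctE.
have := is_derive_primitive (continuous_lipschitz_path (i := i) xc) t1.
move=> H; have := is_deriveD (is_derive_cst (x0 0 i) t 1) H.
by rewrite add0r.
Qed.

Lemma picard_step_coord_continuous x t i : path_continuous x -> -1 < t ->
  {for t, continuous (fun t => picard_step x t 0 i)}.
Proof.
move=> xc t1; apply: differentiable_continuous; apply/derivable1_diffP.
by case: (is_derive_picard_step i xc t1).
Qed.

Lemma picard_step_continuous x : path_continuous x ->
  path_continuous (picard_step x).
Proof.
move=> xc t.
apply: (@continuous_comp _ _ _ (fun t => Num.max t 0) (picard_step x)).
  exact: continuous_max0.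
apply: continuous_row => i; apply: picard_step_coord_continuous => //.
by rewrite lt_max ltrN10 orbT.
Qed.

Lemma picard_step_within x i : path_continuous x ->
  {within `[0, +oo[, continuous (fun t => picard_step x t 0 i)}.
Proof.
move=> xc; apply: continuous_in_subspaceT => t; rewrite inE/= in_itv/= andbT.
move=> t0; apply: picard_step_coord_continuous => //.
by apply: lt_le_trans t0; exact: ltrN10.
Qed.

Lemma expR2L_ge1 t : 0 <= t -> 1 <= expR (2 * L * t).
Proof. by move=> t0; rewrite -expR0 ler_expR !mulr_ge0// ltW. Qed.

(** With the weight expR (2 L t), the Picard operator contracts distances by a
    factor 2 on the whole half-line. *)
Lemma picard_step_weighted x y C :
  path_continuous x -> path_continuous y -> 0 <= C ->
  (forall t, 0 <= t -> `|x t - y t| <= C * expR (2 * L * t)) ->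
  forall t, 0 <= t ->
    `|picard_step x t - picard_step y t| <= C / 2 * expR (2 * L * t).
Proof.
move=> xc yc C0 H t t0; apply/row_normP.
  by rewrite mulr_ge0 ?expR_ge0// divr_ge0.
move=> i; rewrite row_subE.
apply: (@derive_weighted_bound _
  ((fun t => picard_step x t 0 i) - (fun t => picard_step y t 0 i))
  (fun t => F (x (Num.max t 0)) 0 i - F (y (Num.max t 0)) 0 i)) => //.
- by apply: within_continuousB; exact: picard_step_within.
- move=> s s0; have s1 : -1 < s by apply: lt_trans s0; exact: ltrN10.
  by apply: is_deriveB; exact: is_derive_picard_step.
- by rewrite !fctE !picard_step0 subrr normr0 divr_ge0.
- move=> s s0; rewrite (max_l (ltW s0)).
  have -> : F (x s) 0 i - F (y s) 0 i = (F (x s) - F (y s)) 0 i by rewrite !mxE.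
  apply: (le_trans (row_norm_ge _ _)); apply: (le_trans (FL _ _)).
  have -> : C / 2 * (2 * L * expR (2 * L * s)) = L * (C * expR (2 * L * s)).
    by field.
  by rewrite ler_pM2l// H// ltW.
Qed.

(** Global Picard-Lindelof theorem: the Picard iterates converge, for the
    weighted distance, to a fixed point of the Picard operator. *)
Theorem picard_lindelof : exists2 x, solution F x & x 0 = x0.
Proof.
pose X m := iter m picard_step (fun=> x0).
pose E t := expR (2 * L * t).
have E0 t : 0 < E t by exact: expR_gt0.
pose A := `|F x0| / (2 * L).
have A0 : 0 <= A by rewrite divr_ge0// mulr_ge0// ltW.
have Xc m : path_continuous (X m).
  elim: m => [|m IH]; last exact: picard_step_continuous.
  by move=> t; exact: cvg_cst.
have X1 t : 0 <= t -> `|X 1%N t - X 0%N t| <= A * E t.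
  move=> t0; apply/row_normP; first by rewrite mulr_ge0// ltW.
  move=> i; rewrite row_subE.
  apply: (@derive_weighted_bound _
    ((fun t => X 1%N t 0 i) - cst (x0 0 i)) (fun t => F x0 0 i - 0)) => //.
  - apply: within_continuousB; first exact: (picard_step_within (Xc 0%N)).
    by apply: continuous_subspaceT => s; exact: cvg_cst.
  - move=> s s0; have s1 : -1 < s by apply: lt_trans s0; exact: ltrN10.
    apply: is_deriveB; exact: (is_derive_picard_step i (Xc 0%N)).
  - by rewrite !fctE/= picard_step0 subrr normr0.
  - move=> s s0; rewrite subr0; apply: (le_trans (row_norm_ge _ _)).
    rewrite /A mulrA divfK ?gt_eqF ?mulr_gt0// ler_peMr//.
    by apply: expR2L_ge1; exact: ltW.
have XX m t : 0 <= t -> `|X m.+1 t - X m t| <= A / 2 ^+ m * E t.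
  elim: m t => [|m IH] t t0; first by rewrite expr0 divr1; exact: X1.
  have := picard_step_weighted (Xc m.+1) (Xc m) _ IH t0.
  rewrite exprSr invfM mulrA; apply.
  by rewrite divr_ge0// exprn_ge0.
have limX t : exists v : 'rV[R]_n.+1, 0 <= t ->
    forall m, `|v - X m t| <= 2 * (A * E t) / 2 ^+ m.
  have [t0|t0] := leP 0 t; last by exists 0.
  have /choice[l lX] : forall i, exists l, forall m,
      `|l - X m t 0 i| <= 2 * (A * E t) / 2 ^+ m.
    move=> i; apply: geometric_limit => m.
    have := le_trans (row_norm_ge _ i) (XX m t t0).
    by rewrite row_subE mulrAC.
  exists (\row_i l i) => _ m; apply/row_normP.
    apply: divr_ge0; last exact: exprn_ge0.
    by apply: mulr_ge0 => //; apply: mulr_ge0 => //; exact: ltW.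
  by move=> i; rewrite !mxE.
have /choice[V VX] := limX.
have VX' m t : 0 <= t -> `|V t - X m t| <= 2 * A / 2 ^+ m * E t.
  by move=> t0; have := VX t t0 m; rewrite mulrA mulrAC.
(* V is a locally uniform limit of continuous paths. *)
have Vc : path_continuous V.
  move=> t; apply/cvgrPdist_lt => e e0.
  pose K := 2 * A * E (`|t| + 1).
  have [m Km] : exists m, K / 2 ^+ m < e / 3.
    apply: contrapT => /forallNP H.
    have : e / 3 <= 0.
      by apply: (@le_geometric_le0 _ _ K) => m; rewrite leNgt; exact/negP.
    by rewrite leNgt divr_gt0.
  have VXm s : s <= `|t| + 1 ->
      `|V (Num.max s 0) - X m (Num.max s 0)| < e / 3.
    move=> st; apply: le_lt_trans Km.
    have s0 : 0 <= Num.max s 0 by rewrite le_max lexx orbT.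
    apply: (le_trans (VX' m _ s0)).
    rewrite /K mulrAC ler_pM2r ?invr_gt0 ?exprn_gt0//.
    apply: ler_wpM2l; first exact: mulr_ge0.
    rewrite /E ler_expR ler_pM2l ?mulr_gt0//.
    by rewrite ge_max st/= addr_ge0.
  have e3 : 0 < e / 3 by rewrite divr_gt0.
  near=> s.
  have -> : e = e / 3 + e / 3 + e / 3 by field.
  have -> : V (Num.max t 0) - V (Num.max s 0) =
    (V (Num.max t 0) - X m (Num.max t 0)) +
    (X m (Num.max t 0) - X m (Num.max s 0)) -
    (V (Num.max s 0) - X m (Num.max s 0)).
    by rewrite opprB !subrKA.
  apply: (le_lt_trans (ler_normB _ _)); apply: ltrD.
    apply: (le_lt_trans (ler_normD _ _)); apply: ltrD.
      by apply: VXm; rewrite (le_trans (ler_norm _))// lerDl.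
    by near: s; move/cvgrPdist_lt: (Xc m t) => /(_ _ e3).
  apply: VXm; rewrite -lerBlDl.
  have ts : `|t - s| < 1.
    by near: s; apply: cvgr_dist_lt.
  have := ler_norm t; have := ler_norm (- (t - s)); rewrite normrN; lra.
have VE t : 0 <= t -> picard_step V t = V t.
  move=> t0; apply/eqP; rewrite -subr_eq0 -normr_le0.
  apply: (@le_geometric_le0 _ _ (2 * A * E t)) => m.
  have C0 : 0 <= 2 * A / 2 ^+ m.
    by apply: divr_ge0; [exact: mulr_ge0|exact: exprn_ge0].
  have H1 := picard_step_weighted Vc (Xc m) C0 (VX' m) t0.
  have H2 := VX' m.+1 t t0.
  rewrite -(subrKA (X m.+1 t)) -[X m.+1 t - V t]opprB.
  apply: (le_trans (ler_normB _ _)); apply: (le_trans (lerD H1 H2)).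
  rewrite exprSr -/(E t) le_eqVlt; apply/orP; left; apply/eqP; field.
  by rewrite expf_eq0/= pnatr_eq0 andbF.
exists (picard_step V); last exact: picard_step0.
move=> i; split; first exact: picard_step_within.
move=> t t0; rewrite VE ?ltW//.
have t1 : -1 < t by apply: lt_trans t0; exact: ltrN10.
by have := is_derive_picard_step i Vc t1; rewrite max_l// ltW.
Unshelve. all: by end_near. Qed.

End GlobalExistence.

(** * Tails of the cell densities *)

Section Tails.
Local Open Scope classical_set_scope.
Local Open Scope ring_scope.
Context {R : realType}.

(** The number of vehicles in the cells i + 1, ..., n + 1; the shift by one makes
    [tail f 0] the total mass. *)
Definition tail n (f : 'rV[R]_n.+1) (i : nat) : R :=
  \sum_(i.+1 <= j < n.+2) cell f j.

(** The vector whose tails are G 0, ..., G n, and whose tail beyond is 0. *)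
Definition untail n (G : nat -> R) : 'rV[R]_n.+1 :=
  \row_(i < n.+1) (G i - (if (i < n)%N then G i.+1 else 0)).

Section TailTheory.
Variable n : nat.
Implicit Types (f g : 'rV[R]_n.+1).

Lemma cell_ord f (i : 'I_n.+1) : cell f i.+1 = f 0 i.
Proof. by rewrite /cell/= inord_val. Qed.

Lemma tailS f i : (i <= n)%N -> tail f i = cell f i.+1 + tail f i.+1.
Proof. by move=> ik; rewrite /tail big_ltn. Qed.

Lemma tail_out f i : (n < i)%N -> tail f i = 0.
Proof. by move=> ni; rewrite /tail big_geq. Qed.

Lemma tail0 f : tail f 0 = \sum_i f 0 i.
Proof.
rewrite /tail big_add1 big_mkord; apply: eq_bigr => i _; exact: cell_ord.
Qed.

Lemma tail_ind (Q : nat -> Prop) :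
  Q n.+1 -> (forall i, (i <= n)%N -> Q i.+1 -> Q i) ->
  forall i, (i <= n.+1)%N -> Q i.
Proof.
move=> Q0 QS i ni; rewrite -(subKn ni).
elim: (n.+1 - i)%N => [|k IH]; first by rewrite subn0.
have [kn|kn] := leqP k n; last first.
  by rewrite subSS (eqP (ltnW kn : n - k == 0)%N) -(eqP (kn : n.+1 - k == 0)%N).
by apply: QS; rewrite ?subSS ?leq_subr// -subSn.
Qed.

Lemma tailB f g i : tail (f - g) i = tail f i - tail g i.
Proof.
by rewrite /tail -sumrB; apply: eq_bigr => j _; rewrite /cell !mxE.
Qed.

Lemma cell_tail f i : (i <= n)%N -> f 0 (inord i) = tail f i - tail f i.+1.
Proof. by move=> ik; rewrite (tailS f ik) addrK. Qed.

Lemma tail_inj f g : (forall i, (i <= n)%N -> tail f i = tail g i) -> f = g.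
Proof.
move=> fg; apply/rowP => i; have ik : (i <= n)%N by rewrite -ltnS.
rewrite -[i]inord_val !cell_tail// fg//; congr (_ - _).
have [?|?] := leqP i.+1 n; first exact: fg.
by rewrite !tail_out.
Qed.

Lemma tail_untail (G : nat -> R) i : (i <= n)%N -> tail (untail n G) i = G i.
Proof.
move=> ik; suff : tail (untail n G) i = if (i <= n)%N then G i else 0.
  by rewrite ik.
apply: (@tail_ind (fun i => tail (untail n G) i = if (i <= n)%N then G i else 0)).
- by rewrite ltnn tail_out.
- by move=> j jn IH; rewrite tailS// IH jn /cell mxE inordK// subrK.
- exact: leqW.
Qed.

Lemma norm_tail_le f i : `|tail f i| <= n.+1%:R * `|f|.
Proof.
apply: le_trans (ler_norm_sum _ _ _) _.
apply: (@le_trans _ _ (\sum_(i.+1 <= j < n.+2) `|f|)).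
  by apply: ler_sum => j _; exact: row_norm_ge.
rewrite sumr_const_nat -[leLHS]mulr_natl ler_wpM2r// ler_nat subSS.
exact: leq_subr.
Qed.

Lemma norm_le_tail f d : (forall i, `|tail f i| <= d) -> `|f| <= 2 * d.
Proof.
move=> H; apply/row_normP.
  by rewrite mulr_ge0// (le_trans _ (H 0%N)).
move=> i; rewrite -[i]inord_val cell_tail -1?ltnS//.
by apply: le_trans (ler_normB _ _) _; rewrite mulr_natl lerD.
Qed.

Lemma tail_ge0 f i : (forall j, 0 <= f 0 j) -> 0 <= tail f i.
Proof. by move=> f0; apply: sumr_ge0 => j _; exact: f0. Qed.

Lemma tail_nincr f : (forall j, 0 <= f 0 j) ->
  {homo tail f : i j / (i <= j)%N >-> j <= i}.
Proof.
move=> f0; suff H i : tail f i.+1 <= tail f i.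
  move=> i j /subnKC <-; elim: (j - i)%N => [|k IH]; first by rewrite addn0.
  by rewrite addnS (le_trans (H _)).
have [ik|ik] := leqP i n; first by rewrite (tailS _ ik) lerDr; exact: f0.
by rewrite !tail_out// ltnW.
Qed.

End TailTheory.

Section Model.
Variables (T r : nat) (eta p rho : R).
Hypotheses (T1 : (1 <= T)%N) (r1 : (1 <= r)%N).
Local Notation n := (r * T)%N.
Local Notation field := (@delta_field R T r eta p rho).

(** The rate of change of the i-th tail. The subtraction is truncated, so that
    the first r + 1 tails are driven by the total mass G 0. *)
Definition tail_rate (G : nat -> R) (i : nat) : R :=
  eta * ((1 - p) * G i ^+ 2 - rho * G i + p * rho * G (i - r)%N).

Lemma r_le_n : (r <= n)%N. Proof. exact: leq_pmulr. Qed.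

Lemma delta_fieldE f : field f = untail n (tail_rate (tail f)).
Proof.
apply/rowP => i; have ik : (i <= n)%N by rewrite -ltnS.
rewrite !mxE /delta_rate /tail_rate.
rewrite -/(tail f i.+1) [in RHS](tailS f ik).
have [ir|ri] := leqP i.+1 r.
  have -> : (i < n)%N by apply: leq_trans r_le_n.
  have /eqP -> : (i - r == 0)%N by rewrite subn_eq0 ltnW.
  have /eqP -> : (i.+1 - r == 0)%N by rewrite subn_eq0.
  by ring.
have ri' : (r <= i)%N by [].
rewrite /=; case: ifPn => [iltn|].
  rewrite subSn// (tailS f (i := i - r)) ?(leq_trans (leq_subr _ _))//.
  by ring.
rewrite -leqNgt => ni; have -> : nat_of_ord i = n by apply/eqP; rewrite eqn_leq ik.
rewrite subSn ?r_le_n// -/(tail f (n - r)) (@tail_out _ f n.+1)//.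
by ring.
Qed.

Lemma tail_delta_field f i : (i <= n)%N -> tail (field f) i = tail_rate (tail f) i.
Proof. by move=> ik; rewrite delta_fieldE tail_untail. Qed.

Lemma solution_tail x : solution field x -> forall i, (i <= n)%N ->
  {within `[0, +oo[, continuous (fun t => tail (x t) i)} /\
  forall t : R, 0 < t -> is_derive t 1 (fun s => tail (x s) i)
                            (tail_rate (tail (x t)) i).
Proof.
move=> sx i ik.
suff [? H] : {within `[0, +oo[, continuous (fun t => tail (x t) i)} /\
  forall t : R, 0 < t -> is_derive t 1 (fun s => tail (x s) i)
                            (tail (field (x t)) i).
  by split => // t t0; rewrite -tail_delta_field//; exact: H.
apply: (@tail_ind n (fun i =>
  {within `[0, +oo[, continuous (fun t => tail (x t) i)} /\
  forall t : R, 0 < t -> is_derive t 1 (fun s => tail (x s) i)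
                            (tail (field (x t)) i))); last exact: leqW.
- have -> : (fun s => tail (x s) n.+1) = cst 0.
    by apply/funext => s; rewrite tail_out.
  split; first by apply: continuous_subspaceT => s; exact: cvg_cst.
  by move=> t t0; rewrite tail_out//; exact: is_derive_cst.
- move=> {ik}i ik [IHc IHd].
  have -> : (fun s => tail (x s) i) =
      (fun s => x s 0 (inord i)) + (fun s => tail (x s) i.+1).
    by apply/funext => s; rewrite (tailS _ ik) !fctE.
  have [xc xd] := sx (inord i).
  split; first exact: within_continuousD.
  move=> t t0; rewrite (tailS _ ik).
  have ? := xd t t0; have ? := IHd t t0; exact: is_deriveD.
Qed.

(** Conversely, a solution of the equations of the tails yields a solution of
    the model. *)
Lemma solution_untail (G : R -> 'rV[R]_n.+1) :
  solution (fun g => \row_i tail_rate (fun k => g 0 (inord k)) i) G ->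
  solution field (fun t => untail n (fun k => G t 0 (inord k))).
Proof.
move=> sG i.
have tE t j : (j <= n)%N ->
    tail (untail n (fun k => G t 0 (inord k))) j = G t 0 (inord j).
  by move=> jn; rewrite tail_untail.
have rateE t j : (j <= n)%N ->
    tail_rate (tail (untail n (fun k => G t 0 (inord k)))) j =
    tail_rate (fun k => G t 0 (inord k)) j.
  by move=> jn; rewrite /tail_rate !tE// (leq_trans (leq_subr _ _)).
have [Gc Gd] := sG i.
have ik : (i <= n)%N by rewrite -ltnS.
have [iln|nli] := ltnP i n.
- have [Gc' Gd'] := sG (inord i.+1).
  have -> : (fun t => untail n (fun k => G t 0 (inord k)) 0 i) =
      (fun t => G t 0 i) - (fun t => G t 0 (inord i.+1)).
    by apply/funext => t; rewrite mxE iln inord_val !fctE.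
  split; first exact: within_continuousB.
  move=> t t0; rewrite delta_fieldE mxE iln !rateE//.
  have := Gd t t0; have := Gd' t t0; rewrite !mxE inordK// => ? ?.
  exact: is_deriveB.
- have -> : (fun t => untail n (fun k => G t 0 (inord k)) 0 i) = (fun t => G t 0 i).
    by apply/funext => t; rewrite mxE ltnNge nli/= subr0 inord_val.
  split => // t t0; rewrite delta_fieldE mxE ltnNge nli/= subr0 rateE//.
  by have := Gd t t0; rewrite mxE.
Qed.

End Model.
End Tails.

(** * Existence of trajectories *)

Section Existence.
Local Open Scope classical_set_scope.
Local Open Scope ring_scope.
Context {R : realType}.

(** The projection of a onto [0, rho], for 0 <= rho. *)
Definition clamp (rho a : R) : R := Num.min rho (Num.max a 0).

Lemma clamp_itv rho a : 0 <= rho -> 0 <= clamp rho a <= rho.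
Proof. by move=> r0; rewrite /clamp ge_min lexx andbT le_min r0 le_max lexx orbT. Qed.

Lemma clamp_id rho a : 0 <= a <= rho -> clamp rho a = a.
Proof. by move=> /andP[a0 ar]; rewrite /clamp max_l// min_r. Qed.

Lemma clamp_ge rho a : 0 <= rho -> rho <= a -> clamp rho a = rho.
Proof. by move=> r0 ra; rewrite /clamp max_l ?(le_trans r0)// min_l. Qed.

Lemma clamp_le0 rho a : 0 <= rho -> a <= 0 -> clamp rho a = 0.
Proof. by move=> r0 a0; rewrite /clamp max_r// min_r. Qed.

Lemma clamp_lip rho a b : `|clamp rho a - clamp rho b| <= `|a - b|.
Proof.
apply: le_trans (dist_max0 a b); rewrite /clamp.
move: (Num.max a 0) (Num.max b 0) => {}a {}b.
have : a - b <= `|a - b| by exact: ler_norm.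
have : - (a - b) <= `|a - b| by rewrite -normrN ler_norm.
move: `|a - b| => d dn dp; rewrite ler_norml.
by case: (leP rho a) => ?; case: (leP rho b) => ?; apply/andP; split; lra.
Qed.

Section Model.
Variables (T r : nat) (eta p rho : R).
Hypotheses (T1 : (1 <= T)%N) (r1 : (1 <= r)%N).
Hypotheses (eta0 : 0 < eta) (p01 : 0 <= p <= 1) (rho0 : 0 <= rho).
Local Notation n := (r * T)%N.
Local Notation field := (@delta_field R T r eta p rho).
Local Notation rate := (tail_rate r eta p rho).

Let clamped_field (g : 'rV[R]_n.+1) : 'rV[R]_n.+1 :=
  \row_i rate (fun k => clamp rho (g 0 (inord k))) i.

Lemma clamped_field_lip g h :
  `|clamped_field g - clamped_field h| <= (4 * eta * rho + 1) * `|g - h|.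
Proof.
have d0 : 0 <= `|g - h| by [].
have cl k : exists a b, [/\ clamp rho (g 0 (inord k)) = a,
    clamp rho (h 0 (inord k)) = b, 0 <= a <= rho, 0 <= b <= rho
    & - `|g - h| <= a - b <= `|g - h|].
  exists (clamp rho (g 0 (inord k))), (clamp rho (h 0 (inord k))).
  split => //; try exact: clamp_itv.
  rewrite -ler_norml; apply: (le_trans (clamp_lip _ _ _)).
  by have := row_norm_ge (g - h) (inord k); rewrite !mxE.
apply/row_normP.
  by rewrite mulr_ge0// addr_ge0// !mulr_ge0// ltW.
move=> i; rewrite !mxE /tail_rate.
have [a [b [-> -> /andP[a0 ar] /andP[b0 br] /andP[abl abu]]]] := cl i.
have [a' [b' [-> -> _ _ /andP[abl' abu']]]] := cl (i - r)%N.
move: d0 abl abu abl' abu'; move: `|g - h| => d d0 abl abu abl' abu'.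
have -> : eta * ((1 - p) * a ^+ 2 - rho * a + p * rho * a') -
  eta * ((1 - p) * b ^+ 2 - rho * b + p * rho * b') =
  eta * ((1 - p) * (a + b) * (a - b) - rho * (a - b) + p * rho * (a' - b')).
  by ring.
rewrite normrM (gtr0_norm eta0).
have -> : (4 * eta * rho + 1) * d = eta * (4 * rho * d) + d by ring.
rewrite -[leLHS]addr0; apply: lerD => //; rewrite ler_pM2l//.
case/andP: p01 => p0 p1.
have nab : `|a - b| <= d by rewrite ler_norml abl.
have nab' : `|a' - b'| <= d by rewrite ler_norml abl'.
have -> : 4 * rho * d = 2 * rho * d + rho * d + rho * d by ring.
apply: (le_trans (ler_normD _ _)); apply: lerD.
  apply: (le_trans (ler_normB _ _)); apply: lerD; rewrite normrM.
    have ab0 : 0 <= (1 - p) * (a + b).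
      by rewrite mulr_ge0 ?subr_ge0// addr_ge0.
    apply: ler_pM => //; rewrite ger0_norm//.
    have : (1 - p) * (a + b) <= 1 * (a + b).
      by rewrite ler_wpM2r// ?addr_ge0//; lra.
    by lra.
  by rewrite (ger0_norm rho0) ler_wpM2l.
rewrite normrM ger0_norm ?mulr_ge0// ler_pM ?mulr_ge0//.
by rewrite ler_piMl.
Qed.

Theorem solution_exists (x0 : 'rV[R]_n.+1) : phase_space rho x0 ->
  exists2 x, solution field x & x 0 = x0.
Proof.
move=> [x0_ge0 x0_sum].
have L0 : 0 < 4 * eta * rho + 1.
  by rewrite ltr_wpDl// !mulr_ge0// ltW.
have [G sG G0] := picard_lindelof L0 clamped_field_lip (\row_i tail x0 i).
case/andP: p01 => p0 p1.
have G0i i : 0 <= G 0 0 i <= rho.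
  rewrite G0 mxE tail_ge0//= -x0_sum -tail0.
  exact: (tail_nincr x0_ge0 (leq0n i)).
(* The clamped field points inward at both ends of [0, rho]. *)
have rate_le0 t (i : 'I_n.+1) : rho < G t 0 i -> clamped_field (G t) 0 i <= 0.
  move=> Gr; rewrite mxE /tail_rate inord_val clamp_ge// ?(ltW Gr)//.
  have /andP[_] := clamp_itv (G t 0 (inord (i - r))) rho0.
  move: (clamp _ _) => a ar; rewrite pmulr_rle0//.
  have : p * rho * a <= p * rho * rho by rewrite ler_wpM2l// mulr_ge0.
  lra.
have rate_ge0 t (i : 'I_n.+1) : G t 0 i < 0 -> 0 <= clamped_field (G t) 0 i.
  move=> Gr; rewrite mxE /tail_rate inord_val clamp_le0 ?(ltW Gr)//.
  have /andP[a0 _] := clamp_itv (G t 0 (inord (i - r))) rho0.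
  by rewrite expr0n !mulr0 subrr add0r mulr_ge0 ?(ltW eta0)// !mulr_ge0.
have cd (c t : R) : 0 < t -> is_derive t 1 (fun _ : R => c) (0 : R).
  by move=> _; exact: is_derive_cst.
have G_le t i : 0 <= t -> 0 <= G t 0 i <= rho.
  move=> t0; have [Gc Gd] := sG i; have /andP[G0_ge G0_le] := G0i i.
  apply/andP; split.
  - apply: (comparison_le (@within_cst _ 0) Gc (cd 0) Gd ltr01 G0_ge (K := 0) _ t0).
    move=> s s0 /andP[+ _]; rewrite mul0r subr_gt0 sub0r oppr_le0.
    exact: rate_ge0.
  - apply: (comparison_le Gc (@within_cst _ rho) Gd (cd rho) ltr01 G0_le (K := 0) _ t0).
    move=> s s0 /andP[+ _]; rewrite mul0r subr_gt0 subr0.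
    exact: rate_le0.
exists (fun t => untail n (fun k => G t 0 (inord k))).
  apply: solution_untail => // i; have [Gc Gd] := sG i; split => // t t0.
  have := Gd t t0; rewrite !mxE /tail_rate.
  by rewrite !clamp_id//; apply: G_le; exact: ltW.
apply: tail_inj => i ik; rewrite tail_untail// G0 mxE inordK//.
Qed.

End Model.
End Existence.

(** * The chain of equilibrium tails *)

Section Equilibrium.
Context {R : realType}.

(** [chain p rho m.+1] is, for p < 1, the smaller root y' of
    (1 - p) y'^2 - rho y' + p rho y = 0, where y is [chain p rho m]. The
    rationalized form of the quadratic formula also covers p = 1, where the
    equation is linear; for rho = 0 it gives 0 / 0 = 0, as needed. *)
Fixpoint chain (p rho : R) (m : nat) : R :=
  if m is m'.+1 then
    2 * p * rho * chain p rho m' /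
      (rho + Num.sqrt (rho ^+ 2 - 4 * p * (1 - p) * rho * chain p rho m'))
  else rho.

Section Chain.
Variables (p rho : R).
Hypotheses (p01 : 0 <= p <= 1) (rho0 : 0 <= rho).
Local Notation y := (chain p rho).

(** The third equation identifies s, the square root of the discriminant, as
    rho - 2 (1 - p) b; its lower bound rho |1 - 2p| comes from a <= rho. *)
Lemma chain_step (a : R) (s := Num.sqrt (rho ^+ 2 - 4 * p * (1 - p) * rho * a))
    (b := 2 * p * rho * a / (rho + s)) : 0 <= a <= rho ->
  [/\ 0 <= b <= a, rho * `|1 - 2 * p| <= s, 2 * (1 - p) * b = rho - s
    & (1 - p) * b ^+ 2 - rho * b + p * rho * a = 0].
Proof.
move=> /andP[a0 ar]; case/andP: p01 => p0 p1.
have D0 : (rho * `|1 - 2 * p|) ^+ 2 <= rho ^+ 2 - 4 * p * (1 - p) * rho * a.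
  rewrite exprMn real_normK ?num_real//.
  have : 4 * p * (1 - p) * rho * a <= 4 * p * (1 - p) * rho * rho.
    by rewrite ler_wpM2l// !mulr_ge0// subr_ge0.
  rewrite -subr_ge0 => H; rewrite -subr_ge0; apply: le_trans H _.
  by rewrite le_eqVlt; apply/orP; left; apply/eqP; ring.
have s_ge : rho * `|1 - 2 * p| <= s.
  by rewrite -(ger0_norm (_ : 0 <= rho * `|1 - 2 * p|)) ?mulr_ge0// -sqrtr_sqr ler_wsqrtr.
have s0 : 0 <= s by exact: sqrtr_ge0.
have sE : s ^+ 2 = rho ^+ 2 - 4 * p * (1 - p) * rho * a.
  by rewrite sqr_sqrtr// (le_trans _ D0)// sqr_ge0.
have [rho_eq0|rhoN0] := eqVneq rho 0.
  have aE : a = 0 by apply/eqP; rewrite eq_le a0 -rho_eq0 ar.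
  have sE0 : s = 0.
    by apply/eqP; rewrite -[_ == 0]sqrf_eq0 sE aE rho_eq0 mulr0 subr0 expr0n.
  have bE : b = 0 by rewrite /b aE mulr0 mul0r.
  by rewrite bE sE0 aE rho_eq0; split; rewrite ?mul0r ?lexx//; ring.
have rho_gt0 : 0 < rho by rewrite lt0r rhoN0.
have rs : 0 < rho + s by exact: ltr_pwDl.
have bE : b * (rho + s) = 2 * p * rho * a by rewrite /b divfK ?gt_eqF.
have linE : 2 * (1 - p) * b = rho - s.
  apply: (mulIf (lt0r_neq0 rs)).
  have -> : (rho - s) * (rho + s) = rho ^+ 2 - s ^+ 2 by ring.
  have -> : 2 * (1 - p) * b * (rho + s) = 2 * (1 - p) * (b * (rho + s)) by ring.
  by rewrite bE sE; ring.
split => //.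
- rewrite divr_ge0 ?(ltW rs)//= ?mulr_ge0//.
  rewrite ler_pdivrMr// [leRHS]mulrC ler_wpM2r//.
  have : 2 * p - 1 <= `|1 - 2 * p| by rewrite distrC ler_norm.
  move=> H; have := ler_wpM2l rho0 H; lra.
- have -> : p * rho * a = b * (rho + s) / 2 by rewrite bE; field.
  have -> : s = rho - 2 * (1 - p) * b by rewrite linE; ring.
  by field.
Qed.

Lemma chain_itv m : 0 <= y m <= rho.
Proof.
elim: m => [|m IH]; first by rewrite /= rho0 lexx.
have [/andP[b0 ba] _ _ _] := chain_step IH.
by rewrite b0/= (le_trans ba)//; case/andP: IH.
Qed.

Lemma chain_nincr m k : (m <= k)%N -> y k <= y m.
Proof.
move=> /subnKC <-; elim: (k - m)%N => [|j IH]; first by rewrite addn0.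
by rewrite addnS (le_trans _ IH)//; have [/andP[]] := chain_step (chain_itv (m + j)).
Qed.

Lemma chain_root m : (1 - p) * y m.+1 ^+ 2 - rho * y m.+1 + p * rho * y m = 0.
Proof. by have [] := chain_step (chain_itv m). Qed.

Lemma chain_gap m : 2 * (1 - p) * y m.+1 <= rho - rho * `|1 - 2 * p|.
Proof. by have [_ H1 H2 _] := chain_step (chain_itv m); rewrite /= H2 lerB. Qed.

Lemma chain_full m : 1 <= 2 * p \/ rho = 0 -> y m = rho.
Proof.
move=> H.
have [rho_eq0|rhoN0] := eqVneq rho 0.
  by apply/eqP; rewrite eq_le; move: (chain_itv m); rewrite rho_eq0 andbC.
have {}H : 1 <= 2 * p by case: H => // /eqP; rewrite (negPf rhoN0).
have rho_gt0 : 0 < rho by rewrite lt0r rhoN0.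
elim: m => [//|m /= ->].
have -> : rho ^+ 2 - 4 * p * (1 - p) * rho * rho = (rho * (2 * p - 1)) ^+ 2.
  by ring.
rewrite sqrtr_sqr ger0_norm ?mulr_ge0 ?subr_ge0//; field.
rewrite -[_ + _](_ : 2 * p * rho = _); last by ring.
by rewrite mulf_neq0// gt_eqF// (lt_le_trans _ H).
Qed.

End Chain.
End Equilibrium.

(** * Equilibria and their stability *)

Section Stability.
Local Open Scope classical_set_scope.
Local Open Scope ring_scope.
Context {R : realType}.
Variables (T r : nat) (eta p rho : R).
Hypotheses (T1 : (1 <= T)%N) (r1 : (1 <= r)%N).
Hypotheses (eta0 : 0 < eta) (p01 : 0 <= p <= 1) (rho0 : 0 <= rho).
Local Notation n := (r * T)%N.
Local Notation field := (@delta_field R T r eta p rho).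
Local Notation rate := (tail_rate r eta p rho).
Implicit Types (s t : R) (i j : nat).

(** The ceiling of i / r. *)
Definition level (i : nat) : nat := ((i + r.-1) %/ r)%N.

Lemma level0 : level 0 = 0%N.
Proof. by rewrite /level add0n divn_small// prednK. Qed.

Lemma levelS i : (0 < i)%N -> level i = (level (i - r)).+1.
Proof.
move=> i0; have [ri|ir] := leqP r i.
  by rewrite /level -{1}(subnK ri) addnAC divnDr// divnn r1 addn1.
have /eqP -> : (i - r == 0)%N by rewrite subn_eq0 ltnW.
rewrite level0 /level -subn1 addnBA// -addnBAC//.
by rewrite divnDr// divnn r1 divn_small ?addn1// (leq_ltn_trans (leq_subr _ _)).
Qed.

Lemma level_mono i j : (i <= j)%N -> (level i <= level j)%N.
Proof. by move=> ij; rewrite /level leq_div2r// leq_add2r. Qed.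

(** The tails of the stable equilibrium. *)
Definition eq_tail (i : nat) : R := chain p rho (level i).
Local Notation G := eq_tail.
Definition stable_point : 'rV[R]_n.+1 := untail n G.

Lemma eq_tail0 : G 0 = rho.
Proof. by rewrite /eq_tail level0. Qed.

Lemma eq_tail_root i : (1 - p) * G i ^+ 2 - rho * G i + p * rho * G (i - r)%N = 0.
Proof.
case: i => [|i]; first by rewrite sub0n eq_tail0; ring.
by rewrite /eq_tail (levelS (ltn0Sn i)); exact: chain_root.
Qed.

Lemma equilibrium_tailP f : field f = 0 <-> forall i, (i <= n)%N ->
  (1 - p) * tail f i ^+ 2 - rho * tail f i + p * rho * tail f (i - r)%N = 0.
Proof.
split=> [f0 i ik|H].
  have := tail_delta_field eta p rho T1 f ik; rewrite f0 /tail_rate.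
  have -> : tail (0 : 'rV[R]_n.+1) i = 0.
    by apply: big1 => j _; rewrite /cell mxE.
  by move=> /esym/eqP; rewrite mulf_eq0 gt_eqF//= => /eqP.
apply: tail_inj => i ik; rewrite tail_delta_field// /tail_rate H// mulr0.
by apply/esym/big1 => j _; rewrite /cell mxE.
Qed.

Lemma tail_stable_point i : (i <= n)%N -> tail stable_point i = G i.
Proof. exact: tail_untail. Qed.

Lemma stable_point_equilibrium : equilibrium field (phase_space rho) stable_point.
Proof.
split; last first.
  apply/equilibrium_tailP => i ik.
  by rewrite !tail_stable_point ?eq_tail_root// (leq_trans (leq_subr _ _)).
split=> [i|]; last by rewrite -tail0 tail_stable_point// eq_tail0.
rewrite mxE subr_ge0; case: ifP => _; last first.
  by have /andP[] := chain_itv p01 rho0 (level i).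
by apply: chain_nincr => //; apply: level_mono; exact: leqnSn.
Qed.

(** The linear damping coefficient of the deviation from [eq_tail i]; for i > 0
    it is the square root of the discriminant at that step of the chain. *)
Definition gap i := rho - 2 * (1 - p) * G i.

Section Trajectory.
Variable x : R -> 'rV[R]_n.+1.
Hypotheses (sx : solution field x) (x_ps : phase_space rho (x 0)).
Local Notation w i t := (G i - tail (x t) i).

Let w_cont i : (i <= n)%N -> {within `[0, +oo[, continuous (fun t : R => w i t)}.
Proof.
move=> ik; have [xc _] := solution_tail T1 sx ik.
have cc : {within `[0, +oo[, continuous (fun _ : R => G i)}.
  by apply: continuous_subspaceT => s; exact: cvg_cst.
exact: (within_continuousB cc xc).
Qed.

(** The derivative of the deviation [eq_tail i - tail (x t) i]. *)
Definition deviation_rate i t : R := eta *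
  (- (1 - p) * w i t ^+ 2 - gap i * w i t + p * rho * w (i - r)%N t).

Let w_derive i t : (i <= n)%N -> 0 < t ->
  is_derive t 1 (fun t : R => w i t) (deviation_rate i t).
Proof.
move=> ik t0; have [_ xd] := solution_tail T1 sx ik.
have := is_deriveB (is_derive_cst (G i) t 1) (xd t t0).
have -> : 0 - rate (tail (x t)) i = deviation_rate i t; last by [].
rewrite /tail_rate /deviation_rate /gap.
have := eq_tail_root i; move: (G i) (G (i - r)%N) => a b ab.
have -> : p * rho * (b - tail (x t) (i - r)) =
  - ((1 - p) * a ^+ 2 - rho * a) - p * rho * tail (x t) (i - r).
  by rewrite -[LHS]subr0 -ab; ring.
by ring.
Qed.

Lemma deviation_le i c (b K : R) : (i <= n)%N -> 0 < c -> w i 0 <= b ->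
  (forall t, 0 < t -> 0 < w i t - b <= c ->
    deviation_rate i t <= K * (w i t - b)) ->
  forall t, 0 <= t -> w i t <= b.
Proof.
move=> ik c0 w0 H t t0.
apply: (comparison_le (w_cont ik) (@within_cst _ b) (fun t => @w_derive i t ik)
  (fun t _ => is_derive_cst b t 1) c0 w0 (K := K) _ t0).
by move=> s s0 wb; rewrite subr0; exact: H.
Qed.

Lemma deviation_ge i c (b K : R) : (i <= n)%N -> 0 < c -> b <= w i 0 ->
  (forall t, 0 < t -> 0 < b - w i t <= c ->
    - deviation_rate i t <= K * (b - w i t)) ->
  forall t, 0 <= t -> b <= w i t.
Proof.
move=> ik c0 w0 H t t0.
apply: (comparison_le (@within_cst _ b) (w_cont ik) (fun t _ => is_derive_cst b t 1)
  (fun t => @w_derive i t ik) c0 w0 (K := K) _ t0).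
by move=> s s0 wb; rewrite sub0r; exact: H.
Qed.

(** The mass defect w solves w' = eta (1 - p) w (rho - w) and vanishes at 0. *)
Lemma mass_conserved t : 0 <= t -> tail (x t) 0 = rho.
Proof.
move=> t0; case/andP: p01 => p0 p1; have r0 := rho0.
have rateE s : deviation_rate 0 s = eta * ((1 - p) * w 0%N s * (rho - w 0%N s)).
  by rewrite /deviation_rate /gap sub0n eq_tail0; ring.
have w00 : w 0%N 0 = 0 by rewrite eq_tail0 tail0 (proj2 x_ps) subrr.
apply/eqP; rewrite eq_sym -eq_tail0 -subr_eq0 eq_le; apply/andP; split.
- apply: (@deviation_le 0 1 0 (eta * rho)) => //; first by rewrite w00.
  move=> s s0; rewrite subr0 rateE; set v : R := w 0%N s; clearbody v => /andP[v0 v1].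
  rewrite -[leRHS]mulrA ler_pM2l//.
  have h1 : (1 - p) * v * (rho - v) <= (1 - p) * v * rho.
    by rewrite ler_wpM2l ?mulr_ge0 ?subr_ge0 ?(ltW v0)//; lra.
  apply: le_trans h1 _; rewrite [leRHS]mulrC ler_wpM2r//.
  by rewrite ler_piMl ?(ltW v0)//; lra.
- apply: (@deviation_ge 0 1 0 (eta * (rho + 1))) => //; first by rewrite w00.
  move=> s s0; rewrite sub0r rateE; set v : R := w 0%N s; clearbody v => /andP[v0 v1].
  rewrite -mulrN -[leRHS]mulrA ler_pM2l//.
  have -> : - ((1 - p) * v * (rho - v)) = (1 - p) * (- v * (rho - v)) by ring.
  have vr : 0 <= - v * (rho - v) by apply: mulr_ge0; lra.
  apply: (@le_trans _ _ (- v * (rho - v))); first by rewrite ler_piMl//; lra.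
  by rewrite mulrC ler_wpM2r ?(ltW v0)//; lra.
Qed.

Lemma deviation_rate_le i t (e e1 : R) :
  0 <= gap i -> 0 < e -> p * rho * e1 <= (1 - p) * e ^+ 2 + gap i * e ->
  e < w i t -> w (i - r)%N t <= e1 -> deviation_rate i t <= 0.
Proof.
move=> g0 e0 H ew we1; rewrite /deviation_rate pmulr_rle0//.
case/andP: p01 => p0 p1.
have h1 : p * rho * w (i - r)%N t <= p * rho * e1.
  by rewrite ler_wpM2l// mulr_ge0.
have h2 : gap i * e <= gap i * w i t by rewrite ler_wpM2l// ltW.
have h3 : (1 - p) * e ^+ 2 <= (1 - p) * w i t ^+ 2.
  rewrite ler_wpM2l ?subr_ge0// ler_sqr ?nnegrE ?(ltW ew)// ?ltW//.
  exact: lt_trans ew.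
lra.
Qed.

(** The deviation cannot exceed e when the input deviation is at most e1. *)
Lemma deviation_upper i (e e1 : R) : (i <= n)%N ->
  0 <= gap i -> 0 < e -> p * rho * e1 <= (1 - p) * e ^+ 2 + gap i * e ->
  w i 0 <= e -> (forall t, 0 <= t -> w (i - r)%N t <= e1) ->
  forall t, 0 <= t -> w i t <= e.
Proof.
move=> ik g0 e0 H w0 we1.
apply: (@deviation_le i 1 e 0) => // t t0; rewrite mul0r subr_gt0 => /andP[ew _].
by apply: (@deviation_rate_le i t e e1) => //; apply: we1; exact: ltW.
Qed.

(** A lower bound that requires a positive gap, large in comparison with e. *)
Lemma deviation_lower i (e e1 : R) : (i <= n)%N ->
  0 < e -> 4 * e <= gap i -> 2 * (p * rho * e1) <= gap i * e ->
  - e <= w i 0 -> (forall t, 0 <= t -> - e1 <= w (i - r)%N t) ->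
  forall t, 0 <= t -> - e <= w i t.
Proof.
move=> ik e0 H1 H2 w0 we1; case/andP: p01 => p0 p1.
apply: (@deviation_ge i e (- e) 0) => // t t0.
have := we1 t (ltW t0); rewrite mul0r /deviation_rate -mulrN pmulr_rle0//.
move: H1 H2; set v : R := w i t; set u : R := w (i - r)%N t; set d : R := gap i.
clearbody v u d => H1 H2 ue /andP[v1 v2].
have h1 : p * rho * - u <= p * rho * e1.
  by rewrite ler_wpM2l ?mulr_ge0//; lra.
have h2 : (1 - p) * v ^+ 2 <= v ^+ 2 by rewrite ler_piMl ?sqr_ge0//; lra.
have h3 : e * (d / 2) <= (- v) * (d + v).
  apply: (@le_trans _ _ (- v * (d / 2))).
    by rewrite ler_wpM2r//; lra.
  by rewrite ler_wpM2l//; lra.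
lra.
Qed.

(** When all equilibrium tails equal rho, the i-th deviation is the mass
    of the first i cells, and it stays nonnegative. *)
Lemma deviation_ge0 i : (i <= n)%N -> (forall j, G j = rho) ->
  forall t, 0 <= t -> 0 <= w i t.
Proof.
move=> + Gfull; elim/ltn_ind: i => i IH ik.
case/andP: p01 => p0 p1.
have [i0|i0] := posnP i.
  by move=> t t0; rewrite i0 mass_conserved// Gfull subrr.
have IHr t : 0 <= t -> 0 <= w (i - r)%N t.
  apply: IH; last exact: leq_trans (leq_subr _ _) ik.
  by rewrite ltn_subrL r1.
apply: (@deviation_ge i 1 0 (eta * (1 + rho))) => //.
  rewrite subr_ge0 Gfull -(proj2 x_ps) -tail0.
  exact: (tail_nincr (proj1 x_ps) (leq0n i)).
move=> t t0 hv; rewrite sub0r /deviation_rate /gap -mulrN !Gfull.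
rewrite -[leRHS]mulrA ler_pM2l//; move: (IHr t (ltW t0)) hv.
rewrite !Gfull sub0r.
set v : R := rho - tail (x t) i; set u : R := rho - tail (x t) (i - r).
clearbody v u => u0 /andP[v0 v1].
have r0 := rho0.
have h1 : 0 <= p * rho * u by rewrite !mulr_ge0.
have h2 : 0 <= rho * - v by rewrite mulr_ge0// ltW.
have h3 : 0 <= p * (rho * - v) by rewrite mulr_ge0.
have h3' : p * (rho * - v) <= rho * - v by rewrite ler_piMl.
have h4 : (1 - p) * v ^+ 2 <= - v.
  apply: (@le_trans _ _ (v ^+ 2)); first by rewrite ler_piMl ?sqr_ge0//; lra.
  by rewrite -sqrrN expr2 ler_piMl// ltW.
lra.
Qed.

End Trajectory.

(** A tolerance e1 on the input deviation compatible with a margin k. *)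
Lemma input_tolerance (e k : R) : 0 < e -> 0 <= k -> 0 < k \/ p * rho = 0 ->
  exists2 e1, 0 < e1 <= e & p * rho * e1 <= k.
Proof.
move=> e0 k0 H; case/andP: p01 => p0 p1.
have [pr0|prN0] := eqVneq (p * rho) 0.
  by exists e; rewrite ?e0 ?lexx// pr0 mul0r.
have {H} k_gt0 : 0 < k by case: H => // /eqP; rewrite (negPf prN0).
have pr0 : 0 < p * rho by rewrite lt0r prN0 mulr_ge0.
exists (Num.min e (k / (p * rho))).
  by rewrite lt_min e0 divr_gt0//= ge_min lexx.
rewrite mulrC -ler_pdivlMr// ge_min lexx orbT//.
Qed.

(** The regime in which [eq_tail] is constant equal to rho, that is, in which
    the stable equilibrium puts all vehicles in the last cell. *)
Definition saturated : Prop := 1 <= 2 * p \/ rho = 0.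

Lemma saturated_eq_tail : saturated -> forall i, G i = rho.
Proof. by move=> H i; exact: chain_full. Qed.

Lemma not_saturated : ~ saturated -> 2 * p < 1 /\ 0 < rho.
Proof.
move=> H; split; first by rewrite ltNge; apply/negP => ?; apply: H; left.
by rewrite lt0r rho0 andbT; apply/negP => /eqP ?; apply: H; right.
Qed.

Lemma initial_deviation x i : (i <= n)%N ->
  `|G i - tail (x : 'rV[R]_n.+1) i| <= n.+1%:R * `|x - stable_point|.
Proof.
by move=> ik; rewrite -tail_stable_point// -tailB distrC; exact: norm_tail_le.
Qed.

(** Stability of the tails up to index m, with a common radius d. In the induction
    step, the tolerance on the tail of index m + 1 - r provided by the induction
    hypothesis controls the tail of index m + 1. *)
Lemma deviations_small m (e : R) : 0 < e -> exists2 d : R, 0 < d &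
  forall x, solution field x -> phase_space rho (x 0) ->
    `|x 0 - stable_point| < d ->
    forall i, (i <= m)%N -> (i <= n)%N -> forall t, 0 <= t ->
      `|G i - tail (x t) i| <= e.
Proof.
case/andP: p01 => p0 p1; have r0 := rho0.
elim: m e => [|m IH] e e0.
  exists 1 => // x sx xp _ i; rewrite leqn0 => /eqP -> _ t t0.
  by rewrite (mass_conserved sx xp t0) eq_tail0 subrr normr0 ltW.
have [mn|nm] := leqP m.+1 n; last first.
  have [d d0 H] := IH e e0; exists d => // x sx xp xd i im ik.
  by apply: H => //; rewrite -ltnS (leq_ltn_trans ik).
have prev : (m.+1 - r <= m)%N by rewrite leq_subLR -add1n leq_add2r.
have prevn : (m.+1 - r <= n)%N by exact: leq_trans (leq_subr _ _) mn.
suff [e' [e1 [e'0 e'e e10 e1e' H]]] : exists e' e1, [/\ 0 < e', e' <= e, 0 < e1,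
    e1 <= e' & forall x, solution field x -> phase_space rho (x 0) ->
    `|G m.+1 - tail (x 0) m.+1| <= e' ->
    (forall t, 0 <= t -> `|G (m.+1 - r)%N - tail (x t) (m.+1 - r)| <= e1) ->
    forall t, 0 <= t -> `|G m.+1 - tail (x t) m.+1| <= e'].
  have [d d0 Hd] := IH e1 e10.
  exists (Num.min d (e1 / n.+1%:R)); first by rewrite lt_min d0 divr_gt0.
  move=> x sx xp; rewrite lt_min => /andP[xd xe] i im ik t t0.
  have e1e : e1 <= e by exact: le_trans e'e.
  move: im; rewrite leq_eqVlt => /orP[/eqP iE|im]; last first.
    by apply: le_trans e1e; exact: Hd.
  rewrite iE; apply: le_trans e'e; apply: H => //.
    apply: (le_trans (initial_deviation (x 0) mn)); apply: le_trans e1e'.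
    by rewrite mulrC -ler_pdivlMr// ltW.
  by move=> s s0; exact: Hd.
have [sat|nsat] := pselect saturated.
- have Gr := saturated_eq_tail sat.
  have gapE : gap m.+1 = (2 * p - 1) * rho by rewrite /gap Gr; ring.
  have gap0 : 0 <= gap m.+1.
    rewrite gapE; case: sat => [h|->]; last by rewrite mulr0.
    by rewrite mulr_ge0// subr_ge0.
  have [] := @input_tolerance e ((1 - p) * e ^+ 2 + gap m.+1 * e) e0.
  + apply: addr_ge0; apply: mulr_ge0 => //.
    * by rewrite subr_ge0.
    * exact: sqr_ge0.
    * exact: ltW.
  + have [p_eq1|pN1] := eqVneq p 1.
      have [->|rN0] := eqVneq rho 0; first by right; rewrite mulr0.
      left; rewrite gapE p_eq1.
      have -> : (1 - 1) * e ^+ 2 + (2 * 1 - 1) * rho * e = rho * e by ring.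
      by rewrite mulr_gt0// lt0r rN0.
    left; rewrite ltr_wpDr//; first by rewrite mulr_ge0// ltW.
    by rewrite mulr_gt0 ?exprn_gt0// subr_gt0 lt_neqAle pN1.
  move=> e1 /andP[e10 e1e] H; exists e, e1; split => // x sx xp w0 wprev t t0.
  have w_ge0 := deviation_ge0 sx xp mn Gr t0.
  rewrite ger0_norm//; apply: (deviation_upper sx mn gap0 e0 H) => //.
    exact: le_trans (ler_norm _) w0.
  by move=> s s0; exact: le_trans (ler_norm _) (wprev s s0).
- have [p12 rpos] := not_saturated nsat.
  have gap0 : 0 < gap m.+1.
    apply: (@lt_le_trans _ _ (rho * `|1 - 2 * p|)).
      by rewrite mulr_gt0// normr_gt0 subr_eq0 gt_eqF.
    have := chain_gap p01 rho0 (level (m.+1 - r)).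
    by rewrite /gap /eq_tail [level m.+1]levelS//; lra.
  pose e' := Num.min e (gap m.+1 / 4).
  have e'0 : 0 < e' by rewrite lt_min e0 divr_gt0.
  have e'g : 4 * e' <= gap m.+1.
    by rewrite mulrC -ler_pdivlMr// ge_min lexx orbT.
  have ge0 : 0 < gap m.+1 * e' by rewrite mulr_gt0.
  have [] := @input_tolerance e' (gap m.+1 * e' / 2) e'0.
  + by rewrite divr_ge0// ltW.
  + by left; rewrite divr_gt0.
  move=> e1 /andP[e10 e1e] H; exists e', e1; split => //.
    by rewrite ge_min lexx.
  move=> x sx xp w0 wprev t t0; rewrite ler_norml; apply/andP; split.
    apply: (deviation_lower sx mn e'0 e'g (e1 := e1)) => //; first by lra.
      by move: w0; rewrite ler_norml => /andP[].
    by move=> s s0; have := wprev s s0; rewrite ler_norml => /andP[].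
  apply: (deviation_upper sx mn (ltW gap0) e'0 (e1 := e1)) => //.
  + have : 0 <= (1 - p) * e' ^+ 2 by rewrite mulr_ge0 ?sqr_ge0// subr_ge0.
    lra.
  + exact: le_trans (ler_norm _) w0.
  + by move=> s s0; exact: le_trans (ler_norm _) (wprev s s0).
Qed.

Theorem stable_point_lyapunov : lyapunov_stable field (phase_space rho) stable_point.
Proof.
move=> eps eps0; have e0 : 0 < eps / 4 by rewrite divr_gt0.
have [d d0 H] := deviations_small n e0; exists d => // x sx xp xd t t0.
apply: (@le_lt_trans _ _ (2 * (eps / 4))); last by lra.
apply: norm_le_tail => i; have [ik|nik] := leqP i n; last first.
  by rewrite tail_out// normr0 ltW.
by rewrite tailB tail_stable_point// distrC; exact: H.
Qed.

(** An equilibrium outside the saturated regime is determined as soon as its first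
    cell is not empty: its second tail then equals p rho / (1 - p), and
    the larger root of each later quadratic equation is above this value. *)
Lemma equilibrium_eq_stable_point e :
  equilibrium field (phase_space rho) e -> saturated \/ e 0 ord0 <> 0 ->
  e = stable_point.
Proof.
move=> [[e_ge0 e_sum] /equilibrium_tailP eE] H; case/andP: p01 => p0 p1.
have r0 := rho0.
have t_le i : tail e i <= rho.
  by rewrite -e_sum -tail0; exact: (tail_nincr e_ge0 (leq0n i)).
apply: tail_inj; elim/ltn_ind => i IH ik; rewrite tail_stable_point//.
have [i0|i0] := posnP i; first by rewrite i0 eq_tail0 tail0.
have prev : tail e (i - r) = G (i - r).
  rewrite IH ?tail_stable_point ?ltn_subrL ?r1//;
    exact: leq_trans (leq_subr _ _) ik.
have := eE i ik; rewrite prev -(eq_tail_root i) => /eqP.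
rewrite -subr_eq0.
set a : R := tail e i; set g : R := G i; set u : R := G (i - r)%N.
have -> : (1 - p) * a ^+ 2 - rho * a + p * rho * u -
    ((1 - p) * g ^+ 2 - rho * g + p * rho * u) =
    (a - g) * ((1 - p) * (a + g) - rho) by ring.
(* Otherwise (1 - p) (a + g) = rho, as for the two roots of the equation. *)
rewrite mulf_eq0 !subr_eq0 => /orP[/eqP//|/eqP sumE].
have a_ge0 : 0 <= a by exact: tail_ge0.
have a_le : a <= rho by exact: t_le.
have [sat|nsat] := pselect saturated.
  have gr : g = rho by exact: saturated_eq_tail.
  case: sat => [p12|rE]; last by apply/eqP; rewrite eq_le gr a_le rE a_ge0.
  have : (1 - p) * (a + g) <= (a + g) / 2.
    by rewrite mulrC ler_wpM2l// ?gr ?addr_ge0//; lra.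
  rewrite sumE gr; lra.
have [p12 rpos] := not_saturated nsat.
case: H => // e_pos.
have n1 : (1 <= n)%N by rewrite muln_gt0 r1.
have t1 : tail e 1 != rho.
  apply/eqP => t1; apply: e_pos.
  have := cell_tail e (leq0n n).
  by rewrite -(inord_val ord0)/= => ->; rewrite tail0 e_sum t1 subrr.
have : (1 - p) * tail e 1 = p * rho.
  have := eE 1%N n1; have /eqP -> : (1 - r == 0)%N by exact: r1.
  rewrite tail0 e_sum => /eqP.
  have -> : (1 - p) * tail e 1 ^+ 2 - rho * tail e 1 + p * rho * rho =
    (tail e 1 - rho) * ((1 - p) * tail e 1 - p * rho) by ring.
  by rewrite mulf_eq0 subr_eq0 (negPf t1)/= subr_eq0 => /eqP.
have : (1 - p) * a <= (1 - p) * tail e 1.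
  by rewrite ler_wpM2l ?subr_ge0//; exact: (tail_nincr e_ge0 i0).
have := chain_gap p01 rho0 (level (i - r)).
rewrite -levelS// -/(eq_tail i) -/g.
have -> : `|1 - 2 * p| = 1 - 2 * p by rewrite ger0_norm// subr_ge0 ltW.
have : 0 < rho * (1 - 2 * p) by rewrite mulr_gt0// subr_gt0.
lra.
Qed.

Section FirstCellGrowth.
Variable x : R -> 'rV[R]_n.+1.
Hypotheses (sx : solution field x) (x_ps : phase_space rho (x 0)).
Hypotheses (p12 : 2 * p < 1).
Let u t : R := x t 0 ord0.
Let A : R := (1 - 2 * p) * rho.

(** The logistic equation of the first cell. *)
Lemma first_cell_derive t : 0 < t ->
  is_derive t 1 u (eta * (u t * (A - (1 - p) * u t))).
Proof.
move=> t0; have [_ ud] := sx ord0.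
have := ud t t0; rewrite delta_fieldE// mxE/=.
have n1 : (0 < n)%N by rewrite muln_gt0 r1.
have t1 : tail (x t) 1 = rho - u t.
  rewrite -(mass_conserved sx x_ps (ltW t0)) /u.
  have -> : x t 0 ord0 = x t 0 (inord 0) by rewrite -[in LHS](inord_val ord0).
  by rewrite cell_tail//; ring.
rewrite n1 /tail_rate sub0n; have /eqP -> : (1 - r == 0)%N by exact: r1.
rewrite t1 (mass_conserved sx x_ps (ltW t0)).
set l := (X in is_derive _ _ _ X -> _); set l' := (X in _ -> is_derive _ _ _ X).
suff -> : l = l' by [].
by rewrite /l /l' /A; ring.
Qed.

Let u_cont : {within `[0, +oo[, continuous u}.
Proof. by case: (sx ord0). Qed.

(** While u stays below A / 2, its logistic growth rate is at least eta A / 2. *)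
Lemma first_cell_growth : (forall t, 0 <= t -> u t <= A / 2) ->
  forall t, 0 <= t -> u 0 * expR (eta * A / 2 * t) <= u t.
Proof.
move=> uA; case/andP: p01 => p0 p1; have r0 := rho0.
have A0 : 0 <= A by rewrite mulr_ge0// subr_ge0 ltW.
have u00 : 0 <= u 0 by exact: (proj1 x_ps).
have u_ge0 t : 0 <= t -> 0 <= u t.
  move=> t0.
  apply: (comparison_le (@within_cst _ 0) u_cont (fun t _ => is_derive_cst 0 t 1)
    first_cell_derive ltr01 u00 (K := eta * (A + 1)) _ t0) => s s0.
  rewrite !sub0r; set v : R := u s; clearbody v => /andP[v0 v1].
  rewrite -mulrN -[leRHS]mulrA ler_pM2l//.
  have -> : - (v * (A - (1 - p) * v)) = (A - (1 - p) * v) * - v by ring.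
  rewrite ler_wpM2r ?(ltW v0)// lerD2l.
  have : (1 - p) * - v <= 1 * 1 by rewrite ler_pM ?subr_ge0 ?(ltW v0)//; lra.
  by lra.
move=> t t0; set k := eta * A / 2.
have Ed s : 0 < s ->
    is_derive s 1 (fun t => u 0 * expR (k * t)) (u 0 * (k * expR (k * s))).
  by move=> _; exact: is_deriveZ (is_derive_expRM k s).
have E0 : u 0 * expR (k * 0) <= u 0 by rewrite mulr0 expR0 mulr1.
apply: (comparison_le (@within_expRM _ (u 0) k) u_cont Ed first_cell_derive
  ltr01 E0 (K := k) _ t0) => s s0 _.
rewrite [leRHS]mulrBr [k * (u 0 * _)]mulrCA lerD2l lerN2.
have := u_ge0 s (ltW s0); have := uA s (ltW s0).
set v : R := u s; clearbody v => vA v0.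
have -> : k * v = eta * (v * (A / 2)) by rewrite /k; field.
rewrite ler_pM2l// ler_wpM2l//.
have : (1 - p) * v <= v by rewrite ler_piMl//; lra.
lra.
Qed.

End FirstCellGrowth.

Lemma empty_first_cell_unstable e : ~ saturated ->
  phase_space rho e -> e 0 ord0 = 0 ->
  ~ lyapunov_stable field (phase_space rho) e.
Proof.
move=> /not_saturated[p12 rpos] [e_ge0 e_sum] e00 stab.
case/andP: p01 => p0 p1; have eta_gt0 := eta0.
pose A := (1 - 2 * p) * rho; have A0 : 0 < A by rewrite mulr_gt0// subr_gt0.
have [d d0 H] := stab (A / 2) ltac:(by rewrite divr_gt0).
(* The perturbed datum moves from e towards the state v in which all vehicles are
   in the first cell, by convex combination. *)
pose v : 'rV[R]_n.+1 := rho *: delta_mx 0 ord0.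
have v_sum : \sum_i v 0 i = rho.
  rewrite (bigD1 ord0)//= big1 ?addr0; first by rewrite !mxE !eqxx mulr1.
  by move=> i i0; rewrite !mxE eqxx (negPf i0) mulr0.
have v_ge0 (i : 'I_n.+1) : 0 <= v 0 i by rewrite !mxE mulr_ge0// ler0n.
pose D := `|v - e| + 1; have D0 : 0 < D by rewrite ltr_wpDl.
pose s := Num.min 1 (d / D).
have s0 : 0 < s by rewrite lt_min ltr01 divr_gt0.
have s1 : s <= 1 by rewrite ge_min lexx.
pose x0 : 'rV[R]_n.+1 := e + s *: (v - e).
have x0E (i : 'I_n.+1) : x0 0 i = (1 - s) * e 0 i + s * v 0 i by rewrite !mxE; ring.
have x0_ps : phase_space rho x0.
  split=> [i|].
    by rewrite x0E addr_ge0// mulr_ge0 ?subr_ge0// ltW.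
  under eq_bigr do rewrite x0E.
  by rewrite big_split/= -!mulr_sumr e_sum v_sum; ring.
have [x sx xE] := solution_exists T1 eta0 p01 rho0 x0_ps.
have x_ps : phase_space rho (x 0) by rewrite xE.
have xd : `|x 0 - e| < d.
  rewrite xE /x0 addrC addKr normrZ (gtr0_norm s0).
  apply: (@lt_le_trans _ _ (s * D)); first by rewrite ltr_pM2l// ltrDl.
  by rewrite -ler_pdivlMr// ge_min lexx orbT.
have uA t : 0 <= t -> x t 0 ord0 <= A / 2.
  move=> t0; have := H x sx x_ps xd t t0.
  move=> /ltW/(le_trans (row_norm_ge _ ord0)); rewrite !mxE e00 subr0.
  exact: le_trans (ler_norm _).
have u0 : x 0 0 ord0 = s * rho.
  by rewrite xE x0E e00 mulr0 add0r !mxE !eqxx mulr1.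
have sr : 0 < s * rho by rewrite mulr_gt0.
pose k := eta * A / 2; have k0 : 0 < k by rewrite divr_gt0// mulr_gt0.
(* At this time s rho (1 + k t) = s rho + A / 2 exceeds the allowed A / 2. *)
pose t := A / 2 / (s * rho) / k.
have t0 : 0 <= t.
  by apply/ltW/divr_gt0 => //; apply: divr_gt0 => //; exact: divr_gt0.
have := first_cell_growth sx x_ps p12 uA t0; rewrite -/A -/k u0.
have := uA t t0.
have : s * rho * (1 + k * t) <= s * rho * expR (k * t).
  by rewrite ler_pM2l// expR_ge1Dx.
have -> : s * rho * (1 + k * t) = s * rho + A / 2.
  by rewrite /t; field; rewrite !gt_eqF.
lra.
Qed.

Theorem unique_stable_equilibrium :
  unique (@delta_stable_equilibrium R T r eta p rho) stable_point.
Proof.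
split.
  by split; [exact: stable_point_equilibrium|exact: stable_point_lyapunov].
move=> e [eq_e stab_e]; apply/esym.
apply: equilibrium_eq_stable_point => //.
have [sat|nsat] := pselect saturated; first by left.
right => e0; apply: (empty_first_cell_unstable nsat _ e0 stab_e).
by case: eq_e.
Qed.

End Stability.

(** * Refinement of the grid *)

Section Refinement.
Context {R : realType}.
Variables (T r : nat) (p rho : R).
Hypothesis r1 : (1 <= r)%N.

Lemma level_muln m : level r (m * r) = m.
Proof. by rewrite /level divnMDl// divn_small ?addn0// prednK. Qed.

Lemma level_mulnD m k : (0 < k <= r)%N -> level r (m * r + k) = m.+1.
Proof.
move=> /andP[k0 kr]; rewrite /level -addnA divnMDl// -addn1; congr (_ + _)%N.
have -> : (k + r.-1 = 1 * r + k.-1)%N.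
  by rewrite mul1n -(prednK k0) -{2}(prednK r1) !addSn addnC.
by rewrite divnMDl// divn_small ?addn0// prednK.
Qed.

Lemma level1 i : level 1 i = i.
Proof. by rewrite /level addn0 divn1. Qed.

Lemma ceil_cell m : `|Num.ceil ((m * r).+1%:R / r%:R : R)|%N = m.+1.
Proof.
have r0 : (0 : R) < r%:R by rewrite ltr0n.
rewrite (@ceil_def _ _ m.+1%:Z)//; apply/andP; split.
  rewrite ltr_pdivlMr// -[m.+1%:Z]/(Posz m.+1) intS addrAC subrr add0r.
  by rewrite -pmulrn -natrM ltr_nat.
by rewrite ler_pdivrMr// -pmulrn -natrM ler_nat mulSn -addn1 addnC leq_add2r.
Qed.

(** The r-grid equilibrium is the refinement of the one on the grid r = 1:
    [level r] jumps exactly after the multiples of r. *)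
Lemma refine_stable_point :
  refine_grid r (stable_point T 1 p rho) = stable_point T r p rho.
Proof.
apply/rowP => i; rewrite !mxE /eq_tail.
have := ltn_ord i; move: (nat_of_ord i) => {i}i; rewrite ltnS => ik.
rewrite mod0n; set m := (i %/ r)%N; set k := (i %% r)%N.
have kr : (k < r)%N by rewrite ltn_mod.
have iE : i = (m * r + k)%N by exact: divn_eq.
clearbody m k; subst i.
have [k0|k0] := posnP k.
  have mT : (m <= T)%N by move: ik; rewrite k0 addn0 [(r * T)%N]mulnC leq_pmul2r.
  rewrite k0 addn0 ceil_cell /cell mxE /eq_tail inordK ?mul1n ?ltnS// !level1.
  rewrite level_muln -[(m * r).+1]addn1 level_mulnD ?r1//.
  by rewrite addn1 [(r * T)%N]mulnC ltn_pmul2r.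
have mT : (m * r + k < r * T)%N.
  rewrite ltn_neqAle ik andbT; apply/eqP => iT.
  have : (r %| m * r + k)%N by rewrite iT dvdn_mulr.
  by rewrite dvdn_addr ?dvdn_mull// gtnNdvd.
rewrite mT level_mulnD ?k0 ?(ltnW kr)//.
by rewrite -addnS level_mulnD ?subrr.
Qed.

End Refinement.

Theorem theorem6 (R : realType) (rho_max Vmax : R) (P : R -> R) (T : nat)
    (hV : 0 < Vmax) (hT : (1 <= T)%N)
    (hP : forall s : R, 0 <= s <= rho_max -> 0 <= P s <= 1)
    (rho : R) (hrho : 0 <= rho <= rho_max) :
  exists! f1 : 'rV[R]_(1 * T).+1,
    [/\ \sum_(1 <= k < T.+2) cell f1 k = rho,
        forall eta : R, 0 < eta ->
          unique (@delta_stable_equilibrium R T 1 eta (P rho) rho) f1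
      & forall (eta : R) (r : nat), 0 < eta -> (1 <= r)%N ->
          let N := (r * T).+1 in
          let Dv := Vmax / T%:R in
          let dv := Vmax / (N - 1)%:R in
          Dv = r%:R * dv /\
          unique (@delta_stable_equilibrium R T r eta (P rho) rho)
                 (refine_grid r f1)].
Proof.
have p01 : 0 <= P rho <= 1 by exact: hP.
have rho0 : 0 <= rho by case/andP: hrho.
exists (stable_point T 1 (P rho) rho); split.
  split.
  - have -> : \sum_(1 <= k < T.+2) cell (stable_point T 1 (P rho) rho) k =
        tail (stable_point T 1 (P rho) rho) 0.
      have TE : T.+2 = (1 * T).+2 by rewrite mul1n.
      by rewrite /tail TE.
    by rewrite tail_stable_point// eq_tail0.
  - by move=> eta eta0; exact: unique_stable_equilibrium.
  - move=> eta r eta0 r1; split.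
      have T0 : T%:R != 0 :> R by rewrite pnatr_eq0 -lt0n.
      have r0 : r%:R != 0 :> R by rewrite pnatr_eq0 -lt0n.
      by rewrite subn1/= natrM; field; rewrite T0 r0.
    by rewrite refine_stable_point//; exact: unique_stable_equilibrium.
(* Uniqueness of f1 already follows from the grid r = 1, with eta = 1. *)
move=> f1 [_ f1_unique _].
have [f1_stable _] := f1_unique 1 ltr01.
by apply: (unique_stable_equilibrium hT (ltnSn 0) ltr01 p01 rho0).2.
Qed.
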